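(* Let $\Omega\subset\mathbb{R}^d$ be a bounded domain with smooth boundary, $T>0$, $\Omega_T=\Omega\times(0,T)$, and let $f$, $B$, $u_{0\varepsilon}$ satisfy Hypothesis G with constant $A>0$ (see context). Then the quasilinear viscous approximations $(u^\varepsilon)$ (see context) satisfy $$\|u^\varepsilon\|_{L^\infty(\Omega_T)}\le A\qquad\text{for every }\varepsilon>0.$$
   Context: Hypothesis G: (a) $f=(f_1,\dots,f_d)\in (C^2(\mathbb{R}))^d$ and $f'\in (L^\infty(\mathbb{R}))^d$. (b) $B\in C^1(\mathbb{R})\cap L^\infty(\mathbb{R})$ and $B\ge 0$. (c) $u_0\in L^\infty(\Omega)$, and $(u_{0\varepsilon})_{\varepsilon>0}\subset\mathcal{D}(\Omega)=C_c^\infty(\Omega)$ and $A>0$ are such that $\|u_{0\varepsilon}\|_{L^\infty(\Omega)}\le A$ for all $\varepsilon$. (d) $1<p\le2$, $\frac1p+\frac1{p'}=1$, and for every $\psi\in L^{p'}(\mathbb{R})$ with essential compact support, $\mathrm{meas}\{c\in\mathrm{supp}\,\psi:\ \tau+(f_1'(c),\dots,f_d'(c))\cdot\xi=0\}=0$ for all $(\tau,\xi)\in\mathbb{R}\times\mathbb{R}^d$ with $\tau^2+|\xi|^2=1$. Regularized problem: for $\varepsilon,\delta>0$ let $u_{0\delta}^{\varepsilon}\in\mathcal{D}(\Omega)$ satisfy $\|u_{0\delta}^{\varepsilon}\|_{L^\infty(\Omega)}\le A$ and $u_{0\delta}^{\varepsilon}\to u_{0\varepsilon}$ in $L^p(\Omega)$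 as $\delta\to0$, and let $u^{\varepsilon,\delta}\in C^{2+\beta,\frac{2+\beta}{2}}(\overline{\Omega_T})$ (parabolic Hölder space) be the unique classical solution of $$u^{\varepsilon,\delta}_t+\nabla\cdot f(u^{\varepsilon,\delta})=\varepsilon\,\nabla\cdot\big((B(u^{\varepsilon,\delta})+\delta)\nabla u^{\varepsilon,\delta}\big)\ \text{in }\Omega_T,\quad u^{\varepsilon,\delta}=0\ \text{on }\partial\Omega\times(0,T),\quad u^{\varepsilon,\delta}(\cdot,0)=u^{\varepsilon}_{0\delta}.$$ Quasilinear viscous approximations: for each fixed $\varepsilon>0$, $u^\varepsilon$ denotes a limit of $u^{\varepsilon,\delta}$, along a subsequence $\delta\to0$, in $L^p_{loc}(\Omega_T)$ and a.e. in $\Omega_T$. It is the (generalized) solution of $u^\varepsilon_t+\nabla\cdot f(u^\varepsilon)=\varepsilon\nabla\cdot(B(u^\varepsilon)\nabla u^\varepsilon)$ in $\Omega_T$, $u^\varepsilon=0$ on $\partial\Omega\times(0,T)$, $u^\varepsilon(\cdot,0)=u_{0\varepsilon}$. *)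

(* Defs.v *)
From HB Require Import structures.
From mathcomp Require Import all_boot all_order all_algebra.
From mathcomp Require Import all_classical all_reals all_analysis.
Set Implicit Arguments.
Unset Strict Implicit.
Unset Printing Implicit Defensive.
Import Order.TTheory GRing.Theory Num.Theory.
Import numFieldNormedType.Exports.
Local Open Scope classical_set_scope.
Local Open Scope ring_scope.

(* The sigma-algebra on R^n generated by the coordinate functions (the same
   construction as the library's one on tuples); it is the Borel one. *)
Section measurable_rV.
Context {R : realType} (n : nat).

Let coors : 'I_n -> 'rV[R]_n -> R := fun i x => x ord0 i.

Let rV_set0 : g_sigma_preimage coors set0.
Proof. exact: sigma_algebra0. Qed.

Let rV_setC A : g_sigma_preimage coors A -> g_sigma_preimage coors (~` A).
Proof. exact: sigma_algebraC. Qed.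

Let rV_bigcup (F : (set 'rV[R]_n)^nat) :
  (forall i, g_sigma_preimage coors (F i)) ->
  g_sigma_preimage coors (\bigcup_i (F i)).
Proof. exact: sigma_algebra_bigcup. Qed.

HB.instance Definition _ := @isMeasurable.Build default_measure_display
  'rV[R]_n (g_sigma_preimage coors) rV_set0 rV_setC rV_bigcup.

Lemma measurable_coord_rV (i : 'I_n) :
  measurable_fun [set: 'rV[R]_n] (fun x : 'rV[R]_n => x ord0 i).
Proof.
move=> _ Y mY; rewrite setTI; apply: sub_sigma_algebra => /=.
rewrite -bigcup_seq/=; exists i => /=; first by rewrite mem_index_enum.
by exists Y => //; rewrite setTI.
Qed.

Lemma measurable_fun_rV d (T : measurableType d) (f : T -> 'rV[R]_n) :
  (forall i, measurable_fun [set: T] (fun x => f x ord0 i)) ->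
  measurable_fun [set: T] f.
Proof.
move=> mf; suff : g_sigma_preimage (fun i x => f x ord0 i) `<=` measurable.
  rewrite (_ : (fun i x => _) = (fun i => coors i \o f))//.
  rewrite g_sigma_preimage_comp => fS _ A mA.
  by apply: fS; exists A.
apply: smallest_sub; first exact: sigma_algebra_measurable.
case: n f mf => [|m] f mf; first by rewrite big_ord0.
rewrite -bigcup_mkord_ord; apply: bigcup_sub => i Ii.
by move=> A [B mB <-]; exact: mf.
Qed.

End measurable_rV.

Section lebesgue_rV.
Context {R : realType}.

Definition cons_rV n (z : measurableTypeR R * 'rV[R]_n) : 'rV[R]_n.+1 :=
  \row_i (if unlift ord0 i is Some j then z.2 ord0 j else z.1).

Definition uncons_rV n (x : 'rV[R]_n.+1) : measurableTypeR R * 'rV[R]_n :=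
  (x ord0 ord0, \row_j x ord0 (lift ord0 j)).

Lemma cons_rV0 n (z : measurableTypeR R * 'rV[R]_n) : cons_rV z ord0 ord0 = z.1.
Proof. by rewrite mxE unlift_none. Qed.

Lemma cons_rVS n (z : measurableTypeR R * 'rV[R]_n) (j : 'I_n) :
  cons_rV z ord0 (lift ord0 j) = z.2 ord0 j.
Proof. by rewrite mxE liftK. Qed.

Lemma cons_rVK n : cancel (@cons_rV n) (@uncons_rV n).
Proof.
move=> [a x]; rewrite /uncons_rV cons_rV0; congr pair.
by apply/rowP => j; rewrite mxE cons_rVS.
Qed.

Lemma uncons_rVK n : cancel (@uncons_rV n) (@cons_rV n).
Proof.
move=> x; apply/rowP => i; case: (unliftP ord0 i) => [j|] ->.
  by rewrite cons_rVS mxE.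
by rewrite cons_rV0.
Qed.

Lemma measurable_cons_rV n : measurable_fun setT (@cons_rV n).
Proof.
apply: measurable_fun_rV => i; case: (unliftP ord0 i) => [j|] ->.
  rewrite (_ : (fun _ => _) = (fun x : 'rV[R]_n => x ord0 j) \o snd).
    exact: measurableT_comp (measurable_coord_rV j) measurable_snd.
  by apply/funext => z; rewrite cons_rVS.
rewrite (_ : (fun _ => _) = fst); first exact: measurable_fst.
by apply/funext => z; rewrite cons_rV0.
Qed.

Lemma measurable_uncons_rV n : measurable_fun setT (@uncons_rV n).
Proof.
apply/measurable_fun_pair; first exact: measurable_coord_rV.
apply: measurable_fun_rV => i.
rewrite (_ : (fun _ => _) = (fun x : 'rV[R]_n.+1 => x ord0 (lift ord0 i))).
  exact: measurable_coord_rV.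
by apply/funext => x; rewrite mxE.
Qed.

Section step.
Variables (n : nat) (m : {sigma_finite_measure set 'rV[R]_n -> \bar R}).
Local Open Scope ereal_scope.

Definition lebesgue_rVS : set 'rV[R]_n.+1 -> \bar R :=
  pushforward (@lebesgue_measure R \x m) (@cons_rV n).

Let lebesgue_rVS0 : lebesgue_rVS set0 = 0.
Proof. by rewrite /lebesgue_rVS /pushforward preimage_set0 measure0. Qed.

Let lebesgue_rVS_ge0 A : 0 <= lebesgue_rVS A.
Proof. by rewrite /lebesgue_rVS /pushforward; exact: measure_ge0. Qed.

Let mcons A : measurable A -> measurable (@cons_rV n @^-1` A).
Proof. by move=> mA; rewrite -[X in measurable X]setTI; exact: measurable_cons_rV. Qed.

Let lebesgue_rVS_sigma_additive : semi_sigma_additive lebesgue_rVS.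
Proof.
move=> F mF tF mUF; rewrite /lebesgue_rVS /pushforward preimage_bigcup.
apply: measure_semi_sigma_additive.
- by move=> k; exact: mcons.
- apply/trivIsetP => /= i j _ _ ij; rewrite -preimage_setI.
  by move/trivIsetP : tF => /(_ _ _ _ _ ij) ->//; rewrite preimage_set0.
- by rewrite -preimage_bigcup; exact: mcons.
Qed.

HB.instance Definition _ := isMeasure.Build _ _ _ lebesgue_rVS
  lebesgue_rVS0 lebesgue_rVS_ge0 lebesgue_rVS_sigma_additive.

Let lebesgue_rVS_sigma_finite : sigma_finite setT lebesgue_rVS.
Proof.
have /sigma_finiteP[F [FT ndF Foo]] := sigma_finiteT (@lebesgue_measure R).
have /sigma_finiteP[G [GT ndG Goo]] := sigma_finiteT m.
exists (fun k => @uncons_rV n @^-1` (F k `*` G k)).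
  apply/seteqP; split => // x _.
  have : [set: measurableTypeR R] (uncons_rV x).1 by [].
  have : [set: 'rV[R]_n] (uncons_rV x).2 by [].
  rewrite FT GT => -[k _ Gk] [l _ Fl]; exists (maxn k l) => //; split.
  - by move: Fl; exact/subsetPset/ndF/leq_maxr.
  - by move: Gk; exact/subsetPset/ndG/leq_maxl.
move=> k; have [mF ?] := Foo k; have [mG ?] := Goo k; split.
  rewrite -[X in measurable X]setTI; apply: measurable_uncons_rV => //.
  exact: measurableX.
rewrite /lebesgue_rVS /pushforward -comp_preimage.
rewrite (_ : _ \o _ = idfun); last first.
  by apply/funext => z /=; rewrite cons_rVK.
by rewrite preimage_id product_measure1E// lte_mul_pinfty// ge0_fin_numE.
Qed.

HB.instance Definition _ := Measure_isSigmaFinite.Build _ _ _ lebesgue_rVS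
  lebesgue_rVS_sigma_finite.

End step.

(* Lebesgue measure on R^n, as the n-fold product of the one on R. *)
Fixpoint lebesgue_rV n : {sigma_finite_measure set 'rV[R]_n -> \bar R} :=
  if n is m.+1 then lebesgue_rVS (lebesgue_rV m) else \d_(0 : 'rV[R]_0).

Lemma lebesgue_rV_box n (A : 'I_n -> set R) : (forall i, measurable (A i)) ->
  lebesgue_rV n [set x | forall i, A i (x ord0 i)] =
  (\prod_(i < n) (lebesgue_measure (A i)))%E.
Proof.
elim: n A => [|n IH] A mA.
  by rewrite big_ord0 /= diracE mem_set//= => -[].
have mB : measurable [set x : 'rV[R]_n | forall i, A (lift ord0 i) (x ord0 i)].
  rewrite (_ : mkset _ = \bigcap_(i : 'I_n)
    ((fun x : 'rV[R]_n => x ord0 i) @^-1` A (lift ord0 i))).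
    apply: fin_bigcap_measurable => // i _.
    by rewrite -[X in measurable X]setTI; exact: measurable_coord_rV.
  by apply/seteqP; split => [x Ax i _|x Ax i]; exact: Ax.
rewrite big_ord_recl -(IH (fun i => A (lift ord0 i)))//=.
rewrite [RHS](esym (product_measure1E lebesgue_measure (lebesgue_rV n)
  (mA ord0) mB)).
congr (product_measure1 _ _ _); apply/seteqP; split => [z /= Az|z /= [A0 AS] i].
  by split => [|i]; rewrite -?cons_rV0 -?cons_rVS; exact: Az.
by case: (unliftP ord0 i) => [j|] ->; rewrite ?cons_rV0 ?cons_rVS.
Qed.

Definition lebesgue_spacetime n : set ('rV[R]_n * measurableTypeR R) -> \bar R :=
  (lebesgue_rV n \x lebesgue_measure)%E.
HB.instance Definition _ n :=
  Measure.on (@lebesgue_spacetime n).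

End lebesgue_rV.

(* L^p(D) for real-valued functions defined on the whole space: only the values
   on D matter, [g \_ D] being g extended by 0 outside D. *)
Section Lp_on_a_subset.
Context d (T : measurableType d) (R : realType).
Variables (mu : {measure set T -> \bar R}) (p : \bar R) (D : set T).
Implicit Type g : T -> R.

Definition Lspace_on g : Prop := g \_ D \in Lfun mu p.
Definition Lnorm_on g : \bar R := Lnorm mu p (EFin \o (g \_ D)).

End Lp_on_a_subset.

Section one_variable.
Context {R : realType}.
Implicit Type g : R -> R.

Definition class_C (k : nat) g : Prop :=
  (forall j, (j < k)%N -> forall x, derivable (derive1n j g) x 1) /\
  continuous (derive1n k g).

(* The complement of the largest open set on which g vanishes a.e. *)
Definition ess_support g : set R :=
  ~` \bigcup_(U in [set U : set R | open U /\
        {ae @lebesgue_measure R, forall x, U x -> g x = 0}]) U.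

End one_variable.

Section domains.
Context {R : realType} {n : nat}.
Implicit Types (g : 'rV[R]_n -> R) (Omega : set 'rV[R]_n).

Definition partial (i : 'I_n) g : 'rV[R]_n -> R :=
  fun x => 'D_(delta_mx ord0 i) g x.

Definition smooth g : Prop := forall s : seq 'I_n,
  continuous (foldr partial g s) /\
  forall i x, derivable (foldr partial g s) x (delta_mx ord0 i).

(* C_c^oo(Omega), its elements being extended by 0 outside Omega. *)
Definition test_function Omega g : Prop :=
  [/\ smooth g, compact (closure [set x | g x != 0]) &
      closure [set x | g x != 0] `<=` Omega].

Definition boundary (T : topologicalType) (D : set T) : set T :=
  closure D `\` interior D.

(* Near each boundary point, and up to the choice of an axis i and of its
   orientation, Omega is the strict epigraph of a smooth function of the other
   coordinates; gamma is such a function, extended to R^n so as not to depend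
   on the i-th coordinate. *)
Definition smooth_boundary Omega : Prop :=
  forall x0, boundary Omega x0 ->
  exists (i : 'I_n) (b : bool) (gamma : 'rV[R]_n -> R),
    [/\ smooth gamma,
        forall x y : 'rV[R]_n, (forall j, j != i -> x ord0 j = y ord0 j) ->
          gamma x = gamma y &
        \forall x \near x0, Omega x <-> gamma x < (-1) ^+ b * x ord0 i].

Record smooth_bounded_domain Omega : Prop := SmoothBoundedDomain {
  domain_open : open Omega ;
  domain_connected : connected Omega ;
  domain_nonempty : Omega !=set0 ;
  domain_bounded : bounded_set Omega ;
  domain_smooth : smooth_boundary Omega }.

End domains.

Section parabolic.
Context {R : realType} {n : nat}.
Implicit Types (Q : set ('rV[R]_n * R)) (u v : 'rV[R]_n * R -> R).

Definition cylinder (Omega : set 'rV[R]_n) (T : R) : set ('rV[R]_n * R) :=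
  Omega `*` `]0, T[.

Definition dirx (i : 'I_n) : 'rV[R]_n * R := (delta_mx ord0 i, 0).
Definition dirt : 'rV[R]_n * R := (0, 1).
Definition Dx (i : 'I_n) u : 'rV[R]_n * R -> R := fun z => 'D_(dirx i) u z.
Definition Dt u : 'rV[R]_n * R -> R := fun z => 'D_dirt u z.

(* v, defined on the open set Q, belongs to C(closure Q). *)
Definition continuous_upto Q v : Prop :=
  exists2 w : 'rV[R]_n * R -> R,
    {within closure Q, continuous w} & forall z, Q z -> v z = w z.

Definition holder_x (a : R) Q v : Prop := exists C : R,
  forall x y t, Q (x, t) -> Q (y, t) -> `|v (x, t) - v (y, t)| <= C * `|x - y| `^ a.

Definition holder_t (a : R) Q v : Prop := exists C : R,
  forall x s t, Q (x, s) -> Q (x, t) -> `|v (x, s) - v (x, t)| <= C * `|s - t| `^ a.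

Definition bounded_continuous_upto Q v : Prop :=
  [bounded v z | z in Q] /\ continuous_upto Q v.

(* C^{2+beta, (2+beta)/2}(closure Q), in the sense of Ladyzhenskaya, Solonnikov
   and Ural'ceva: the derivatives D_t^r D_x^s u with 2r + s <= 2 are continuous
   up to the boundary of Q, those with 2r + s = 2 are Hoelder continuous with
   exponent beta in x, and those with 0 < 2r + s <= 2 are Hoelder continuous
   with exponent (2 + beta - 2r - s) / 2 in t. *)
Record parabolic_holder2 (beta : R) Q u : Prop := ParabolicHolder2 {
  ph_bounded : [bounded u z | z in closure Q] ;
  ph_continuous : {within closure Q, continuous u} ;
  ph_derivable_t : forall z, Q z -> derivable u z dirt ;
  ph_derivable_x : forall i z, Q z -> derivable u z (dirx i) ;
  ph_derivable_xx : forall i j z, Q z -> derivable (Dx i u) z (dirx j) ;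
  ph_continuous_t : bounded_continuous_upto Q (Dt u) ;
  ph_continuous_x : forall i, bounded_continuous_upto Q (Dx i u) ;
  ph_continuous_xx : forall i j, bounded_continuous_upto Q (Dx j (Dx i u)) ;
  ph_holder_x_t : holder_x beta Q (Dt u) ;
  ph_holder_x_xx : forall i j, holder_x beta Q (Dx j (Dx i u)) ;
  ph_holder_t_t : holder_t (beta / 2) Q (Dt u) ;
  ph_holder_t_xx : forall i j, holder_t (beta / 2) Q (Dx j (Dx i u)) ;
  ph_holder_t_x : forall i, holder_t ((1 + beta) / 2) Q (Dx i u) }.

Record regularized_solution (beta : R) (Omega : set 'rV[R]_n) (T : R)
    (f : 'I_n -> R -> R) (B : R -> R) (eps delta : R) (u0 : 'rV[R]_n -> R) u :
    Prop := RegularizedSolution {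
  rs_regular : parabolic_holder2 beta (cylinder Omega T) u ;
  rs_equation : forall z, cylinder Omega T z ->
    Dt u z + \sum_(i < n) Dx i (f i \o u) z =
    eps * \sum_(i < n) Dx i (fun w => (B (u w) + delta) * Dx i u w) z ;
  rs_boundary : forall x t, boundary Omega x -> 0 < t < T -> u (x, t) = 0 ;
  rs_initial : forall x, Omega x -> u (x, 0) = u0 x }.

Definition viscous_limit (p : R) Q (v : R -> 'rV[R]_n * R -> R) u : Prop :=
  exists delta : nat -> R,
  [/\ (forall k, 0 < delta k) /\ delta k @[k --> \oo] --> 0,
      forall K, compact K -> K `<=` Q ->
        Lspace_on (@lebesgue_spacetime R n) p%:E K u,
      forall K, compact K -> K `<=` Q ->
        Lnorm_on (@lebesgue_spacetime R n) p%:E K (v (delta k) \- u)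
          @[k --> \oo] --> 0%E &
      {ae @lebesgue_spacetime R n, forall z, Q z ->
        v (delta k) z @[k --> \oo] --> u z}].

End parabolic.

Section hypotheses.
Context {R : realType} {n : nat}.

Record hypothesis_G (Omega : set 'rV[R]_n) (f : 'I_n -> R -> R) (B : R -> R)
    (u0 : 'rV[R]_n -> R) (u0e : R -> 'rV[R]_n -> R) (A p p' : R) : Prop :=
  HypothesisG {
  G_f_C2 : forall i, class_C 2 (f i) ;
  G_df_bounded : forall i, derive1 (f i) \in Lfun (@lebesgue_measure R) +oo%E ;
  G_B_C1 : class_C 1 B ;
  G_B_bounded : B \in Lfun (@lebesgue_measure R) +oo%E ;
  G_B_ge0 : forall c, 0 <= B c ;
  G_u0 : Lspace_on (lebesgue_rV n) +oo%E Omega u0 ;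
  G_u0e_test : forall eps, 0 < eps -> test_function Omega (u0e eps) ;
  G_A_gt0 : 0 < A ;
  G_u0e_bounded : forall eps, 0 < eps ->
    (Lnorm_on (lebesgue_rV n) +oo%E Omega (u0e eps) <= A%:E)%E ;
  G_p : 1 < p <= 2 ;
  G_conjugate : p^-1 + p'^-1 = 1 ;
  G_nondegenerate : forall psi : R -> R,
    psi \in Lfun (@lebesgue_measure R) p'%:E -> compact (ess_support psi) ->
    forall (tau : R) (xi : 'rV[R]_n),
    tau ^+ 2 + \sum_(i < n) xi ord0 i ^+ 2 = 1 ->
    lebesgue_measure (ess_support psi `&`
      [set c | tau + \sum_(i < n) derive1 (f i) c * xi ord0 i = 0]) = 0%E }.

Record regularized_data (Omega : set 'rV[R]_n) (u0e : R -> 'rV[R]_n -> R)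
    (A p : R) (u0ed : R -> R -> 'rV[R]_n -> R) : Prop := RegularizedData {
  rd_test : forall eps delta, 0 < eps -> 0 < delta ->
    test_function Omega (u0ed eps delta) ;
  rd_bounded : forall eps delta, 0 < eps -> 0 < delta ->
    (Lnorm_on (lebesgue_rV n) +oo%E Omega (u0ed eps delta) <= A%:E)%E ;
  rd_cvg : forall eps, 0 < eps ->
    Lnorm_on (lebesgue_rV n) p%:E Omega (u0ed eps delta \- u0e eps)
      @[delta --> 0^'+] --> 0%E }.

Record viscous_approximations (beta : R) (Omega : set 'rV[R]_n) (T : R)
    (f : 'I_n -> R -> R) (B : R -> R) (u0e : R -> 'rV[R]_n -> R) (A p : R)
    (u0ed : R -> R -> 'rV[R]_n -> R) (ued : R -> R -> 'rV[R]_n * R -> R)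
    (ue : R -> 'rV[R]_n * R -> R) : Prop := ViscousApproximations {
  va_data : regularized_data Omega u0e A p u0ed ;
  va_solution : forall eps delta, 0 < eps -> 0 < delta ->
    regularized_solution beta Omega T f B eps delta (u0ed eps delta)
      (ued eps delta) ;
  va_limit : forall eps, 0 < eps ->
    viscous_limit p (cylinder Omega T) (ued eps) (ue eps) }.

End hypotheses.

(* Main.v *)
(* The bound is the weak maximum principle for u^{eps,delta}, passed to the a.e.
   limit delta -> 0. Where all the D_{x_i} u vanish, the flux terms and the terms
   B'(u) (D_{x_i} u)^2 drop out and the equation reads
   u_t = eps (B(u) + delta) Laplacian(u); at a maximum of u - eta t over
   closure(Omega) x [0, t_1] which is neither initial nor lateral, the right-hand
   side is <= 0 while u_t >= eta > 0. The same applies to -u. The initial bound,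
   given a.e., holds everywhere on Omega because the data are continuous and
   nonempty open sets have positive measure. *)
Require Import Defs.
From HB Require Import structures.
From mathcomp Require Import all_boot all_order all_algebra.
From mathcomp Require Import all_classical all_reals all_analysis.
From mathcomp Require Import ess_sup_inf ring lra.
Import Order.TTheory GRing.Theory Num.Theory.
Import numFieldNormedType.Exports.
Local Open Scope classical_set_scope.
Local Open Scope ring_scope.

(** * One-variable calculus at a maximum *)

(** If the second derivative at [c] were positive, the first one, zero at [c], would be positive
    just to its right, and [g] would increase strictly there. *)
Lemma second_derivative_test (R : realType) (g : R -> R) (c : R) :
  (\forall x \near c, derivable g x 1) -> derivable (derive1 g) c 1 ->
  (\forall x \near c, g x <= g c) ->
  derive1 g c = 0 /\ derive1 (derive1 g) c <= 0.
Proof.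
move=> dg ddg gmax.
have : \forall x \near c, derivable g x 1 /\ g x <= g c by exact: filterI.
move=> /nbhs_ballP[e /= e0 He].
have {}He x : x \in `]c - e, c + e[ -> derivable g x 1 /\ g x <= g c.
  rewrite in_itv/= => xr; apply: He; rewrite /ball /= distrC ltr_distl.
  exact: xr.
have cI : c \in `]c - e, c + e[ by rewrite in_itv/=; lra.
have g'c : derive1 g c = 0.
  rewrite derive1E; apply: (@derive_val _ _ _ _ _ _ _
    (@derive1_at_max R g (c - e) (c + e) c _ _ cI _)).
  - lra.
  - by move=> t /He[].
  - by move=> t /He[].
split => //; rewrite leNgt; apply/negP => g''.
have : \forall h \near (0 : R)^', 0 < h^-1 *: (derive1 g (h + c) - derive1 g c).
  rewrite derive1E in g''.
  have /cvgr_gt := ddg; move=> /(_ _ g''); apply: filterS => h /=.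
  by rewrite [h *: 1]mulr1.
move=> /nbhs_ballP[e1 /= e10 He1].
pose r := Num.min e e1 / 2.
have rme : 0 < r by rewrite divr_gt0// lt_min e0.
have re : r < e.
  by rewrite ltr_pdivrMr// (@le_lt_trans _ _ e) ?ge_min ?lexx// ltr_pMr// ltr1n.
have re1 : r < e1.
  by rewrite ltr_pdivrMr// (@le_lt_trans _ _ e1) ?ge_min ?lexx ?orbT// ltr_pMr// ltr1n.
have : g c < g (c + r).
  apply: (@gtr0_derive1_lt_cc _ g c (c + r)).
  - by move=> x; rewrite in_itv/= => xc; apply He; rewrite in_itv/=; lra.
  - move=> x; rewrite in_itv/= => /andP[cx xcr].
    have := He1 (x - c); rewrite /ball /= sub0r normrN gtr0_norm ?subr_gt0//.
    move=> /(_ ltac:(lra)) /(_ ltac:(lra)).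
    by rewrite g'c subr0 subrK pmulr_rgt0// invr_gt0 subr_gt0.
  - apply: derivable_within_continuous => x; rewrite in_itv/= => xc.
    by apply He; rewrite in_itv/=; lra.
  - by rewrite in_itv/=; lra.
  - by rewrite in_itv/=; lra.
  - lra.
apply/negP; rewrite -leNgt; apply He; rewrite in_itv/=; lra.
Qed.

(** The left difference quotients at [c] are at least [k]. The one-sided form serves a maximum that
    may sit at the last time of an interval, where only earlier times can be compared. *)
Lemma derive1_ge_left (R : realType) (g : R -> R) (c k : R) :
  derivable g c 1 -> (\forall h \near 0^'+, g (c - h) <= g c - k * h) ->
  k <= derive1 g c.
Proof.
move=> dg gk; rewrite derive1E.
have dg' : h^-1 *: ((g \o shift c) (h *: (1 : R)) - g c) @[h --> 0^'-] --> 'D_1 g c.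
  apply: cvg_trans dg; apply: cvg_app.
  by move=> D [e e0 De]; exists e => // x xe xlt0; apply: De => //; rewrite lt_eqF.
apply: (cvgr_to_ge dg').
have : \forall h \near (0:R)^'-, g (c + h) <= g c + k * h.
  move: gk => [e /= e0 He]; exists e => //= h he h0.
  have := He (- h); rewrite /ball_ /= !opprK in he *.
  by rewrite mulrN opprK; apply; rewrite ?oppr_gt0// add0r -normrN -sub0r.
move=> H; near=> h; have h0 : h < 0 by near: h; exact: nbhs_left_lt.
have : g (c + h) <= g c + k * h by near: h.
rewrite /= [h *: _]mulr1 => Hh.
rewrite -[_ *: _]/(h^-1 * _) [h^-1 * _]mulrC ler_ndivlMr// lerBlDr.
rewrite [h + c]addrC [k * h + _]addrC.
Unshelve. all: by end_near. Qed.

(** * Directional derivatives as derivatives along a line *)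

Section lines.
Context {R : realType} {V : normedModType R}.
Implicit Types (F : V -> R) (a v : V).

Definition on_line F a v : R -> R := fun h => F (h *: v + a).

Lemma on_line_quotient F a v (s : R) :
  (fun h : R => h^-1 *: ((on_line F a v \o shift s) (h *: (1 : R)) - on_line F a v s)) =
  (fun h : R => h^-1 *: ((F \o shift (s *: v + a)) (h *: v) - F (s *: v + a))).
Proof.
by apply/funext => h; rewrite /on_line /= [h *: 1]mulr1 scalerDl addrA.
Qed.

Lemma derivable_on_line F a v (s : R) :
  derivable (on_line F a v) s 1 <-> derivable F (s *: v + a) v.
Proof. by rewrite /derivable on_line_quotient. Qed.

Lemma derive1_on_line F a v (s : R) :
  derive1 (on_line F a v) s = 'D_v F (s *: v + a).
Proof. by rewrite derive1E /derive on_line_quotient. Qed.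

Lemma derive1_on_lineE F a v :
  derive1 (on_line F a v) = on_line (fun z => 'D_v F z) a v.
Proof. by apply/funext => s; rewrite derive1_on_line. Qed.

Lemma near_on_line a v (P : set V) :
  (\forall z \near a, P z) -> \forall h \near (0 : R), P (h *: v + a).
Proof.
move=> Pa.
have : h *: v + a @[h --> (0 : R)] --> a.
  rewrite -[X in _ --> X]add0r -(scale0r v).
  by apply: cvgD; [apply: cvgZ; [exact: cvg_id|exact: cvg_cst]|exact: cvg_cst].
exact.
Qed.

Lemma directional_second_derivative_test F a v :
  (\forall z \near a, derivable F z v) ->
  derivable (fun z => 'D_v F z) a v ->
  (\forall h \near (0 : R), F (h *: v + a) <= F a) ->
  'D_v F a = 0 /\ 'D_v (fun z => 'D_v F z) a <= 0.
Proof.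
move=> dF ddF Fmax.
have := @second_derivative_test R (on_line F a v) 0.
rewrite derive1_on_lineE derive1_on_line derivable_on_line.
rewrite /on_line scale0r add0r.
apply => //.
by apply: filterS (near_on_line _ v _ dF) => h; exact: (derivable_on_line F a v h).2.
Qed.

(** Along the line this is the one-variable chain rule, so it suffices that [F] has a derivative in
    the direction [v], which is what [parabolic_holder2] records. *)
Lemma derive_comp1 F (g : R -> R) a v :
  derivable F a v -> derivable g (F a) 1 ->
  'D_v (g \o F) a = derive1 g (F a) * 'D_v F a.
Proof.
move=> dF dg.
have E G : 'D_v G a = derive1 (on_line G a v) 0.
  by rewrite derive1_on_line scale0r add0r.
rewrite !E -[on_line (g \o F) a v]/(g \o on_line F a v).
rewrite derive1_comp; first by rewrite {1}/on_line scale0r add0r.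
  by apply/derivable_on_line; rewrite scale0r add0r.
by rewrite /on_line scale0r add0r.
Qed.

Lemma derivable_comp1 F (g : R -> R) a v :
  derivable F a v -> derivable g (F a) 1 -> derivable (g \o F) a v.
Proof.
move=> dF dg.
rewrite -[a]add0r -(scale0r v).
apply/derivable_on_line; rewrite -[on_line (g \o F) a v]/(g \o on_line F a v).
apply/derivable1_diffP/differentiable_comp; apply/derivable1_diffP.
  by apply/derivable_on_line; rewrite scale0r add0r.
by rewrite /on_line scale0r add0r.
Qed.

End lines.

(** * The space-time cylinder and the weak maximum principle *)

Lemma cylinderP (R : realType) n (Omega : set 'rV[R]_n) (T : R) x t :
  cylinder Omega T (x, t) <-> Omega x /\ 0 < t < T.
Proof. by rewrite /cylinder /=; split=> [[]|[]] /=; rewrite in_itv. Qed.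

Lemma cylinder_open (R : realType) n (Omega : set 'rV[R]_n) (T : R) :
  open Omega -> open (cylinder Omega T).
Proof.
move=> oO; rewrite openE => -[x t] /cylinderP[Ox tT].
exists (Omega, `]0, T[%classic) => /=.
  split; first exact: open_nbhs_nbhs.
  by apply: open_nbhs_nbhs; split; [exact: itv_open|rewrite /= in_itv].
by case=> y s /= [Oy]; rewrite in_itv /= => sT; exact/cylinderP.
Qed.

Lemma closure_cylinder (R : realType) n (Omega : set 'rV[R]_n) (T : R) x t :
  0 < T -> closure Omega x -> 0 <= t <= T ->
  closure (cylinder Omega T) (x, t).
Proof.
move=> T0 cx tT W [[U1 U2] /= [nU1 nU2] UW].
have [y [Oy U1y]] := cx _ nU1.
have : closure `]0, T[%classic t.
  move=> U /nbhs_ballP[e /= e0 eU].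
  (* As [r * 3 <= T], at least one of [t + r] and [t - r] lies in the open interval, even when [t]
     is an endpoint. *)
  pose r := Num.min e T / 3.
  have r0 : 0 < r by rewrite divr_gt0// lt_min e0.
  have re : r < e.
    by rewrite ltr_pdivrMr// (@le_lt_trans _ _ e) ?ge_min ?lexx// ltr_pMr// ltr1n.
  have rT : r * 3 <= T by rewrite divfK// ge_min lexx orbT.
  have [tr|tr] := leP (t + r) (T - r).
    exists (t + r); split; first by rewrite /= in_itv/=; lra.
    by apply: eU; rewrite /ball /= ltr_distl; lra.
  exists (t - r); split; first by rewrite /= in_itv/=; lra.
  by apply: eU; rewrite /ball /= ltr_distl; lra.
move=> /(_ _ nU2)[s [sT U2s]].
by exists (y, s); split; [|exact: UW].
Qed.

(** The equation enters only through the sign of [Dt v] at spatial critical points with nonpositive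
    pure second derivatives, a form that both [u] and [- u] can satisfy. *)
Lemma weak_maximum_principle (R : realType) n (Omega : set 'rV[R]_n.+1)
    (T M : R) (v : 'rV[R]_n.+1 * R -> R) :
  open Omega -> bounded_set Omega -> 0 < T ->
  {within closure (cylinder Omega T), continuous v} ->
  (forall z, cylinder Omega T z -> derivable v z dirt) ->
  (forall i z, cylinder Omega T z -> derivable v z (dirx i)) ->
  (forall i z, cylinder Omega T z -> derivable (Dx i v) z (dirx i)) ->
  (forall z, cylinder Omega T z -> (forall i, Dx i v z = 0) ->
    (forall i, Dx i (Dx i v) z <= 0) -> Dt v z <= 0) ->
  (forall x, Omega x -> v (x, 0) <= M) ->
  (forall x t, boundary Omega x -> 0 < t < T -> v (x, t) <= M) ->
  forall z, cylinder Omega T z -> v z <= M.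
Proof.
move=> oO bO T0 cv dt dx dxx sub vinit vbnd [x1 t1] Qz1.
have /cylinderP[Ox1 t1T] := Qz1.
rewrite leNgt; apply/negP => Mv1.
(* At a maximum of v - eta t the space derivatives of v are those of the
   perturbed function, so only the time derivative sees the perturbation. *)
pose eta := (v (x1, t1) - M) / (t1 * 2).
have eta0 : 0 < eta by rewrite divr_gt0; lra.
(* The perturbation uses up half of the excess over [M] at [(x1, t1)], so [w] still exceeds [M]
   there, and hence at its maximum. *)
have etat1 : eta * t1 = (v (x1, t1) - M) / 2.
  by rewrite /eta; field; lra.
(* Stopping at [t1 < T] keeps a maximum reached at the final time below [T], within reach of the
   differential hypotheses. *)
pose K : set ('rV[R]_n.+1 * R) := closure Omega `*` `[0, t1].
pose w (z : 'rV[R]_n.+1 * R) := v z - eta * z.2.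
have KQ : K `<=` closure (cylinder Omega T).
  move=> [x t] [/= cx]; rewrite in_itv/= => tt1.
  by apply: closure_cylinder => //; lra.
have cptK : compact K.
  apply: compact_setX; last exact: segment_compact.
  apply: bounded_closed_compact; last exact: closed_closure.
  move: bO; rewrite /bounded_set /bounded_near; apply: filterS => r Or.
  have : closure Omega `<=` closed_ball_ Num.norm 0 r.
    rewrite closureE; apply: smallest_sub; first exact: closed_closed_ball_.
    by move=> x /Or; rewrite /closed_ball_ /= sub0r normrN.
  by move=> cr x /cr; rewrite /closed_ball_ /= sub0r normrN.
have cw : {within K, continuous w}.
  move=> z; apply: cvgB; first exact: (continuous_subspaceW KQ cv).
  apply: (continuous_subspaceT (f := fun z : 'rV[R]_n.+1 * R => eta * z.2)) => y.
  by apply: cvgM; [exact: cvg_cst|exact: cvg_snd].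
have K1 : K (x1, t1).
  by split; [exact: subset_closure|rewrite /= in_itv/=; lra].
have [[x0 t0] /set_mem[/= cx0]] := compact_EVT_max (ex_intro _ _ K1) cptK cw.
rewrite in_itv/= => t0t1 wmax.
have {}wmax x t : closure Omega x -> 0 <= t <= t1 -> w (x, t) <= w (x0, t0).
  by move=> cx tt; apply: wmax; apply/mem_set; split=> //=; rewrite in_itv.
have Mv0 : M < v (x0, t0).
  have := wmax _ _ (subset_closure Ox1) (_ : 0 <= t1 <= t1).
  rewrite /w /= etat1 => /(_ ltac:(lra)).
  have : 0 <= eta * t0 by apply: mulr_ge0; lra.
  lra.
(* The initial bound is known on [Omega] only, and the lateral one for positive times only. If
   [t0 = 0], continuity carries [M < v] from [(x0, 0)] to some [(y, 0)] with [y] in [Omega]. *)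
have t0_gt0 : 0 < t0.
  rewrite lt_neqAle; apply/andP; split; last lra.
  apply/eqP => t00; rewrite -t00 in Mv0.
  have cQ0 x : closure Omega x -> closure (cylinder Omega T) (x, 0).
    by move=> cx; apply: closure_cylinder => //; lra.
  have : within (closure (cylinder Omega T)) (nbhs (x0, 0)) [set z | M < v z].
    by rewrite (nbhs_subspace_in (cQ0 _ cx0)); exact: cvgr_gt (cv (x0, 0)) _ Mv0.
  move=> [[U1 U2] /= [nU1 nU2] UM].
  have [y [Oy U1y]] := cx0 _ nU1.
  have := UM (y, 0) (conj U1y (nbhs_singleton nU2)) (cQ0 _ (subset_closure Oy)).
  by rewrite /= ltNge vinit.
have Ox0 : Omega x0.
  apply: contrapT => nOx0.
  have : v (x0, t0) <= M.
    apply: vbnd; last lra.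
    by split => // /interior_subset.
  by lra.
have Qz0 : cylinder Omega T (x0, t0) by apply/cylinderP; split=> //; lra.
have nearQ : \forall z \near (x0, t0), cylinder Omega T z.
  by apply: open_nbhs_nbhs; split => //; exact: cylinder_open.
(* Along a spatial line the time stays equal to [t0], so the term in [eta] cancels and [v] itself
   has a local maximum. *)
have crit i : Dx i v (x0, t0) = 0 /\ Dx i (Dx i v) (x0, t0) <= 0.
  apply: directional_second_derivative_test.
  - by apply: filterS nearQ => z; exact: dx.
  - exact: dxx.
  - have := near_on_line (x0, t0) (dirx i) _ nearQ.
    apply: filterS => h.
    have -> : h *: dirx i + (x0, t0) = (h *: delta_mx ord0 i + x0, t0).
      by congr (_, _); rewrite /= scaler0 add0r.
    move=> /cylinderP[Oh _].
    have := wmax _ t0 (subset_closure Oh) ltac:(lra).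
    by rewrite /w /= lerD2r.
have : Dt v (x0, t0) <= 0.
  by apply: sub => // i; case: (crit i).
apply/negP; rewrite -ltNge; apply: (lt_le_trans eta0).
rewrite /Dt -[(x0, t0)]add0r -(scale0r dirt) -derive1_on_line.
(* Since [t0] may equal [t1], [w] is compared at the times [t0 - h] only; this makes the time
   derivative at least [eta]. *)
apply: derive1_ge_left.
  by apply/derivable_on_line; rewrite scale0r add0r; exact: dt.
near=> h.
have h0 : 0 < h by near: h; exact: nbhs_right_gt.
have ht0 : h < t0 by near: h; exact: nbhs_right_lt.
have := wmax x0 (t0 - h) cx0 ltac:(lra).
have onl s : on_line v (x0, t0) dirt s = v (x0, t0 + s).
  by rewrite /on_line; congr (v (_, _)); rewrite /= ?scaler0 ?add0r// [s *: 1]mulr1 addrC.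
rewrite !onl /w /= sub0r addr0.
nra.
Unshelve. all: by end_near.
Qed.

(** * A priori bound for the regularized solutions *)

Section regularized_solutions.
Context {R : realType} {n : nat}.
Variables (beta : R) (Omega : set 'rV[R]_n) (T : R) (f : 'I_n -> R -> R)
  (B : R -> R) (eps delta : R) (u0 : 'rV[R]_n -> R) (u : 'rV[R]_n * R -> R).
Hypothesis u_sol : regularized_solution beta Omega T f B eps delta u0 u.

Lemma regularized_equation_critical z : (forall i c, derivable (f i) c 1) ->
  (forall c, derivable B c 1) -> cylinder Omega T z -> (forall i, Dx i u z = 0) ->
  Dt u z = eps * \sum_(i < n) (B (u z) + delta) * Dx i (Dx i u) z.
Proof.
move=> fC BC Qz crit; have reg := rs_regular u_sol.
have du i : derivable u z (dirx i) by exact: (ph_derivable_x reg).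
have dB : derivable B (u z) 1 by exact: BC.
have := rs_equation u_sol Qz.
rewrite big1 ?addr0 => [->|i _]; last first.
  rewrite /Dx (derive_comp1 _ _ _ _ (du i) (fC i _)).
  by rewrite -/(Dx i u z) crit mulr0.
congr (_ * _); apply: eq_bigr => i _.
have dBu : derivable (fun w => B (u w) + delta) z (dirx i).
  apply: (@derivableD _ _ _ (B \o u) (cst delta)) => /=.
    exact: (derivable_comp1 u B z (dirx i) (du i) dB).
  exact: derivable_cst.
have dxu : derivable (Dx i u) z (dirx i) by exact: (ph_derivable_xx reg).
(* In the product rule, the term that differentiates [B (u w) + delta] carries the factor
   [Dx i u z], which is zero. *)
rewrite {1}/Dx (deriveM dBu dxu).
by rewrite crit [0 *: _]mul0r addr0.
Qed.

End regularized_solutions.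

Lemma regularized_solution_bound (R : realType) n beta
    (Omega : set 'rV[R]_n.+1) (T : R) (f : 'I_n.+1 -> R -> R)
    (B : R -> R) (eps delta A : R) (u0 : 'rV[R]_n.+1 -> R)
    (u : 'rV[R]_n.+1 * R -> R) :
  open Omega -> bounded_set Omega -> 0 < T ->
  (forall i c, derivable (f i) c 1) -> (forall c, derivable B c 1) ->
  (forall c, 0 <= B c) ->
  0 <= eps -> 0 <= delta -> 0 <= A ->
  (forall x, Omega x -> `|u0 x| <= A) ->
  regularized_solution beta Omega T f B eps delta u0 u ->
  forall z, cylinder Omega T z -> `|u z| <= A.
Proof.
move=> oO bO T0 fC BC B0 eps0 delta0 A0 u0A usol z Qz.
have reg := rs_regular usol.
have eqn w := regularized_equation_critical beta Omega T f B eps delta u0 u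
  usol w fC BC.
have dDx i w : cylinder Omega T w -> derivable (Dx i u) w (dirx i).
  exact: (ph_derivable_xx reg).
have DxN i w : cylinder Omega T w -> Dx i (\- u) w = - Dx i u w.
  by move=> Qw; rewrite /Dx (deriveN (ph_derivable_x reg Qw)).
(* Differentiating a second time requires the identity on a neighbourhood of [w], hence the openness
   of the cylinder. *)
have nDxN i w : cylinder Omega T w -> {near w, Dx i (\- u) =1 \- Dx i u}.
  move=> Qw; have : \forall w' \near w, cylinder Omega T w'.
    by apply: open_nbhs_nbhs; split => //; exact: cylinder_open.
  by apply: filterS => w' /DxN.
have DxxN i w : cylinder Omega T w -> Dx i (Dx i (\- u)) w = - Dx i (Dx i u) w.
  move=> Qw; rewrite {1}/Dx (near_eq_derive _ (nDxN i w Qw)).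
  by rewrite (deriveN (dDx i w Qw)).
rewrite ler_norml; apply/andP; split.
  rewrite lerNl.
  apply: (weak_maximum_principle R n Omega T A (\- u) oO bO T0 _ _ _ _ _ _ _ z Qz).
  - by move=> w; apply: cvgN; exact: (ph_continuous reg).
  - by move=> w Qw; apply: derivableN; exact: (ph_derivable_t reg).
  - by move=> i w Qw; apply: derivableN; exact: (ph_derivable_x reg).
  - move=> i w Qw; apply: (@near_eq_derivable _ _ _ (\- Dx i u)).
      by apply: filterS (nDxN i w Qw) => ? ->.
    by apply: derivableN; exact: dDx.
  - move=> w Qw crit sd.
    rewrite /Dt (deriveN (ph_derivable_t reg Qw)) oppr_le0.
    rewrite -/(Dt u w) eqn//.
      apply: mulr_ge0 => //; apply: sumr_ge0 => i _; apply: mulr_ge0.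
        by rewrite addr_ge0.
      by have := sd i; rewrite DxxN// oppr_le0.
    by move=> i; apply/eqP; rewrite -oppr_eq0 -DxN// crit.
  - move=> x Ox /=; rewrite (rs_initial usol)//.
    by have := u0A x Ox; rewrite ler_norml lerNl => /andP[].
  - by move=> x t bx tT /=; rewrite (rs_boundary usol)// oppr0.
apply: (weak_maximum_principle R n Omega T A u oO bO T0 _ _ _ _ _ _ _ z Qz).
- exact: (ph_continuous reg).
- by move=> w Qw; exact: (ph_derivable_t reg).
- by move=> i w Qw; exact: (ph_derivable_x reg).
- exact: dDx.
- move=> w Qw crit sd.
  rewrite eqn//.
  apply: mulr_ge0_le0 => //; apply: sumr_le0 => i _; apply: mulr_ge0_le0 => //.
  by rewrite addr_ge0.
- move=> x Ox; rewrite (rs_initial usol)//.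
  by have := u0A x Ox; rewrite ler_norml => /andP[].
- by move=> x t bx tT; rewrite (rs_boundary usol).
Qed.

(** * From essential to pointwise bounds, and the limit *)

(** Balls for the norm of ['rV[R]_n] are boxes, so a nonempty open set contains a box with sides of
    length [2 * e], which has positive measure. *)
Lemma negligible_open_rV (R : realType) n (U : set 'rV[R]_n) :
  open U -> (lebesgue_rV n).-negligible U -> U = set0.
Proof.
move=> oU [N [mN N0 UN]]; rewrite -subset0 => x Ux.
have /nbhs_ballP[e /= e0 eU] : nbhs x U by exact: open_nbhs_nbhs.
pose I i := `]x ord0 i - e, x ord0 i + e[%classic : set R.
pose box := [set y : 'rV[R]_n | forall i, I i (y ord0 i)].
have mI i : measurable (I i) by exact: measurable_itv.
have mbox : measurable box.
  rewrite (_ : box = \bigcap_(i : 'I_n)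
    ((fun y : 'rV[R]_n => y ord0 i) @^-1` I i)).
    apply: fin_bigcap_measurable => // i _.
    by rewrite -[X in measurable X]setTI; exact: measurable_coord_rV.
  by apply/seteqP; split => [y Ay i _|y Ay i]; exact: Ay.
have boxN : box `<=` N.
  move=> y by_; apply/UN/eU; split => // i j.
  by have := by_ j; rewrite (ord1 i) /I /= in_itv/= /ball /= -ltr_distl distrC.
have : (lebesgue_rV n box <= 0)%E.
  by rewrite -N0; apply: (le_measure (lebesgue_rV n)); rewrite ?inE.
rewrite /box lebesgue_rV_box//.
apply/negP; rewrite -ltNge.
apply: (big_ind (fun y : \bar R => 0 < y)%E) => //.
  by move=> a b a0 b0; exact: mule_gt0.
move=> i _; rewrite lebesgue_measure_itv/= lte_fin.
rewrite ifT; last lra.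
by rewrite -EFinB lte_fin; lra.
Qed.

(** The points of [Omega] where the absolute value of [g] exceeds [A] form an open negligible set,
    hence an empty one. *)
Lemma Lnorm_on_pinfty_continuous (R : realType) n (Omega : set 'rV[R]_n)
    (g : 'rV[R]_n -> R) (A : R) :
  open Omega -> continuous g ->
  (Lnorm_on (lebesgue_rV n) +oo%E Omega g <= A%:E)%E ->
  forall x, Omega x -> `|g x| <= A.
Proof.
move=> oO cg; rewrite /Lnorm_on unlock.
case: ifPn => [_ /ess_supP aeA|]; last first.
  (* In this branch the whole space has measure zero and the norm is a default value; being open and
     negligible, the space would be empty, against [x]. *)
  rewrite -leNgt measure_le0 => /eqP muT0 _ x.
  have : (lebesgue_rV n).-negligible [set: 'rV[R]_n] by exists setT; split.
  by move=> /(negligible_open_rV R n _ openT) /seteqP[/(_ x I)].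
move=> x Ox; rewrite leNgt; apply/negP => Agx.
suff : Omega `&` [set y | A < `|g y|] = set0 by move=> /seteqP[/(_ x (conj Ox Agx))].
apply: negligible_open_rV.
  apply: openI => //.
  rewrite (_ : [set y | _] = (Num.norm \o g) @^-1` [set r | A < r])//.
  apply: open_comp; last exact: open_gt.
  by move=> y _; apply: continuous_comp; [exact: cg|exact: norm_continuous].
apply: negligibleS aeA => y [Oy /= Ay]; rewrite /patch mem_set// lee_fin.
by apply/negP; rewrite -ltNge.
Qed.

Theorem lemma3p1 (R : realType) (d : nat) (d_gt0 : (0 < d)%N)
    (Omega : set 'rV[R]_d) (Omega_domain : smooth_bounded_domain Omega)
    (T : R) (T_gt0 : 0 < T)
    (f : 'I_d -> R -> R) (B : R -> R)
    (u0 : 'rV[R]_d -> R) (u0e : R -> 'rV[R]_d -> R) (A p p' : R)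
    (G : hypothesis_G Omega f B u0 u0e A p p')
    (beta : R) (beta01 : 0 < beta < 1)
    (u0ed : R -> R -> 'rV[R]_d -> R) (ued : R -> R -> 'rV[R]_d * R -> R)
    (ue : R -> 'rV[R]_d * R -> R)
    (ue_approx : viscous_approximations beta Omega T f B u0e A p u0ed ued ue) :
  forall eps : R, 0 < eps ->
    (Lnorm_on (@lebesgue_spacetime R d) +oo%E (cylinder Omega T) (ue eps)
       <= A%:E)%E.
Proof.
move=> eps eps0.
have ued_bound delta z : 0 < delta -> cylinder Omega T z ->
    `|ued eps delta z| <= A.
  (* Positivity of [d] puts the dimension in the form [n.+1] of the maximum principle. *)
  move=> delta0 Qz; case: d d_gt0 Omega Omega_domain f u0 u0e G u0ed ued ue
    ue_approx z Qz => // n _ {}Omega OmegaD {}f {}u0 {}u0e {}G {}u0ed {}ued {}ue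
    [data sol _] z Qz.
  have [oO _ _ bO _] := OmegaD.
  have fD i c : derivable (f i) c 1 by apply: (G_f_C2 G i).1 0%N _ _.
  have BD c : derivable B c 1 by apply: (G_B_C1 G).1 0%N _ _.
  apply: (regularized_solution_bound _ _ _ _ _ _ _ _ _ _ _ _ oO bO T_gt0 fD BD
    (G_B_ge0 G) (ltW eps0) (ltW delta0) (ltW (G_A_gt0 G)) _
    (sol eps delta eps0 delta0) z Qz).
  apply: Lnorm_on_pinfty_continuous => //; last exact: (rd_bounded data).
  (* Smoothness at the empty list of partial derivatives gives continuity of the datum itself. *)
  by have [smooth0 _ _] := rd_test data eps0 delta0; exact: (smooth0 [::]).1.
have [delta [[delta0 _] _ _ cvg_ae]] := va_limit ue_approx eps0.
rewrite /Lnorm_on unlock; case: ifPn => _; last by rewrite lee_fin (ltW (G_A_gt0 G)).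
(* Points violating the bound lie in the null set where convergence fails: elsewhere in the cylinder
   the bound passes to the limit, and outside it the extension by zero leaves [0 <= A]. *)
apply/ess_supP; move: cvg_ae; apply: negligibleS => z; apply: contra_not => cvgz /=.
rewrite /patch; case: ifPn => [/set_mem Qz|_]; last first.
  by rewrite normr0 lee_fin (ltW (G_A_gt0 G)).
rewrite lee_fin.
apply: (cvgr_to_le (cvg_norm (cvgz Qz))).
by apply: nearW => k; exact: ued_bound.
Qed.
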